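(* For every real $\alpha<2$ and every $C>0$ there exist $f\in L^2_{\tt RF}$ and a measurable set $E\subset Q$ of positive measure such that $$\int_Q |f|^2\, d\mu > \exp\Bigl(C\log^{\alpha}\Bigl(\frac{2}{\mu(E)}\Bigr)\Bigr) \int_E |f|^2\, d\mu .$$ In other words, the exponent $6$ in the inequality $\int_Q |f|^2\, d\mu \le \exp\bigl(C\log^6(2/\mu(E))\bigr)\int_E|f|^2\,d\mu$ (valid with an absolute constant $C$ for all $f\in L^2_{\tt RF}$ and all $E\subset Q$ of positive measure) cannot be replaced by any number less than $2$.
   Context: Let $\xi_k$, $k\in\mathbb Z$, be independent Rademacher random variables (values $\pm1$ with probability $\tfrac12$ each) on a probability space $(\Omega,\mathcal P)$. Let $\mathbb T=\mathbb R/\mathbb Z$ with normalized Lebesgue measure $m$, and let $Q=\Omega\times\mathbb T$ with the product measure $\mu=\mathcal P\times m$. $L^2_{\tt RF}\subset L^2(Q)=L^2(Q,\mu)$ is the closed linear span of the functions $(\omega,\theta)\mapsto \xi_k(\omega)e^{2\pi i k\theta}$, $k\in\mathbb Z$. *)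

(* Defs.v *)
From mathcomp Require Export all_boot all_order all_algebra.
From mathcomp Require Export complex.
From mathcomp Require Export all_classical all_reals all_analysis.

Set Implicit Arguments.
Unset Strict Implicit.
Unset Printing Implicit Defensive.

Import Order.TTheory GRing.Theory Num.Theory.
Import numFieldNormedType.Exports.

Local Open Scope classical_set_scope.
Local Open Scope ring_scope.
Local Open Scope complex_scope.

Section RademacherVariables.
Context {d : measure_display} {Omega : measurableType d} {R : realType}.
Variable P : probability Omega R.

Definition rademacher (X : {RV P >-> R}) : Prop :=
  P (X @^-1` [set 1]) = (2^-1)%:E /\ P (X @^-1` [set -1]) = (2^-1)%:E.

(* Mutual independence: the product rule for every finite subfamily (s lists
   its distinct indices) and all Borel sets. *)
Definition mutually_independent (I : choiceType) (X : I -> {RV P >-> R}) :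
    Prop :=
  forall (s : seq I) (B : I -> set R), uniq s ->
    (forall i, i \in s -> measurable (B i)) ->
    P (\bigcap_(i in [set` s]) (X i @^-1` B i)) =
    (\prod_(i <- s) P (X i @^-1` B i))%E.

End RademacherVariables.

Section RademacherFourierSeries.
Context {d : measure_display} {Omega : measurableType d} {R : realType}.

(* The circle R/Z is represented by its fundamental domain [0, 1[, so that its
   normalized Lebesgue measure is the restriction of lebesgue_measure, and
   measures and integrals on Omega x R/Z are those of P \x lebesgue_measure
   on the following set. *)
Definition Q : set (Omega * R) := [set: Omega] `*` `[0, 1[.

(* |z|^2, as a real number *)
Definition sqnormc (z : R[i]) : R := ComplexField.Normc.normc z ^+ 2.

(* exp (2 pi i k theta) *)
Definition fourier_char (k : int) (theta : R) : R[i] :=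
  let t := 2 * pi * k%:~R * theta in cos t +i* sin t.

Variable P : probability Omega R.

Definition sqintegral (A : set (Omega * R)) (f : Omega * R -> R[i]) : \bar R :=
  (\int[P \x lebesgue_measure]_(z in A) (sqnormc (f z))%:E)%E.

(* Elements of L^2(Q) are represented by functions; their values outside Q
   are irrelevant. *)
Definition L2 (f : Omega * R -> R[i]) : Prop :=
  [/\ measurable_fun Q (fun z => complex.Re (f z)),
      measurable_fun Q (fun z => complex.Im (f z)) &
      (sqintegral Q f < +oo)%E].

Definition rademacher_poly (xi : int -> {RV P >-> R}) (s : seq int)
    (a : int -> R[i]) (z : Omega * R) : R[i] :=
  \sum_(k <- s) a k * ((xi k z.1)%:C * fourier_char k z.2).

(* The closure in L^2(Q) of the complex linear span of the functions
   xi_k(omega) exp (2 pi i k theta). *)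
Definition L2_RF (xi : int -> {RV P >-> R}) (f : Omega * R -> R[i]) : Prop :=
  L2 f /\
  forall eps : R, 0 < eps -> exists (s : seq int) (a : int -> R[i]),
    (sqintegral Q (fun z => f z - rademacher_poly xi s a z)%R < eps%:E)%E.

End RademacherFourierSeries.

(* Main.v *)
Require Import Defs.
From mathcomp Require Import measurable_realfun ring lra.

Set Implicit Arguments.
Unset Strict Implicit.
Unset Printing Implicit Defensive.

Import Order.TTheory GRing.Theory Num.Theory.
Import numFieldNormedType.Exports.
Local Open Scope classical_set_scope.
Local Open Scope ring_scope.

(** For a natural number N, take the polynomial
      f = \sum_(0 <= k <= N) 'C(N, k) xi_k e_k,   e_k(theta) = exp(2 pi i k theta).
    On the event A on which xi_k = (-1)^k for all k <= N, the binomial theorem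
    gives f = (1 - e_1)^N ([binomial_polyE]).  The event A has probability
    2^-(N+1) by independence, which costs only O(N) in log(2 / mu E).  The
    high-order zero of (1 - e_1)^N at theta = 0 then makes f tiny on
    E = A x [0, h[ with h = 2^-(N+4): there |f|^2 <= (16 h)^N = 2^-(N^2)
    ([binomial_poly_small]).  On the other hand |f| >= 1 on A x [1/4, 1/2[, so
    that the integral of |f|^2 over Q is at least 2^-(N+3)
    ([binomial_poly_large]).  Since mu E = 2^-(2N+5), the ratio of the two
    integrals is at least 2^(N^2), whose logarithm is quadratic in N, whereas
    log(2 / mu E) is linear in N; hence no power alpha < 2 of the latter can
    dominate the former ([quadratic_beats_powR]).

    The variables xi_k take the values 1 and -1 only almost surely, so f is
    bounded only off a null set; this is what the square integrability of f
    ([rademacher_poly_L2_RF]) rests on. *)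

(** * Powers of 1 - exp(2 pi i theta) *)

Section CharacterPowers.
Variable R : realType.
Implicit Types (x : R[i]%C) (t : R).

Lemma sqnormc_ge0 x : 0 <= sqnormc x.
Proof. exact: sqr_ge0. Qed.

Lemma sqnormcE x : sqnormc x = complex.Re x ^+ 2 + complex.Im x ^+ 2.
Proof.
by case: x => a b; rewrite /sqnormc/= sqr_sqrtr// addr_ge0 ?sqr_ge0.
Qed.

Lemma sqnormcX x n : sqnormc (x ^+ n) = sqnormc x ^+ n.
Proof.
rewrite /sqnormc; elim: n => [|n IH].
  by rewrite !expr0 ComplexField.Normc.normc1 expr1n.
by rewrite (exprS x) ComplexField.Normc.normcM exprMn IH -exprS.
Qed.

Lemma fourier_charX (k : nat) t :
  fourier_char k t = fourier_char 1 t ^+ k.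
Proof.
elim: k => [|k IH].
  by rewrite /fourier_char expr0 mulr0 mul0r cos0 sin0.
rewrite exprSr -IH /fourier_char.
have -> : 2 * pi * k.+1%:~R * t = 2 * pi * k%:~R * t + 2 * pi * 1 * t :> R.
  by rewrite -!pmulrn -[k.+1%:R]natr1; ring.
rewrite cosD sinD; apply/eqP; rewrite eq_complex /= -!pmulrn.
by rewrite eqxx /= addrC (mulrC (sin _)) eqxx.
Qed.

Lemma sqnormc_1Bfourier_char t :
  sqnormc (1 - fourier_char 1 t) = 2 * (1 - cos (2 * pi * t)).
Proof.
rewrite sqnormcE /fourier_char /= mulr1.
have := cos2Dsin2 (2 * pi * t); set c := cos _; set s := sin _ => h.
by rewrite sub0r sqrrN; have -> : s ^+ 2 = 1 - c ^+ 2 by [rewrite -h; ring]; ring.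
Qed.

Lemma cos_ge1B (u : R) : 0 <= u -> 1 - u <= cos u.
Proof.
move=> u0.
have cos_cont : {within `[0, u], continuous (@cos R)}.
  by apply: continuous_subspaceT; exact: continuous_cos.
have [c _] := MVT_segment u0 (fun v _ => is_derive_cos v) cos_cont.
rewrite cos0 subr0 => h.
have := sin_le1 c => sc; nra.
Qed.

(** A bound linear in t, obtained from [cos_ge1B], in place of the sharper
    quadratic one: it only changes the constant in front of N^2. *)
Lemma sqnormc_1Bfourier_char_le t :
  0 <= t -> sqnormc (1 - fourier_char 1 t) <= 16 * t.
Proof.
move=> t0; rewrite sqnormc_1Bfourier_char.
have pi4 : (pi : R) < 4 by have := @pihalf_lt2 R; lra.
have pi0 := @pi_gt0 R.
have := @cos_ge1B (2 * pi * t); have : 0 <= 2 * pi * t by nra.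
move=> h /(_ h); nra.
Qed.

(** On this quarter of the circle the cosine is nonpositive. *)
Lemma sqnormc_1Bfourier_char_ge1 t :
  4^-1 <= t <= 2^-1 -> 1 <= sqnormc (1 - fourier_char 1 t).
Proof.
move=> /andP[t1 t2]; rewrite sqnormc_1Bfourier_char.
have pi0 := @pi_gt0 R.
have : 0 <= cos (pi - 2 * pi * t).
  by apply: cos_ge0_pihalf; apply/andP; split; nra.
rewrite cosB cospi sinpi mul0r addr0 => h; lra.
Qed.

End CharacterPowers.

(** * Rademacher polynomials belong to the space *)

Section RademacherPolynomials.
Context {d : measure_display} {Omega : measurableType d} {R : realType}.
Variables (P : probability Omega R) (xi : int -> {RV P >-> R}).
Local Notation mu := (P \x (@lebesgue_measure R))%E.

Lemma measurable_rademacher_poly s a :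
  measurable_fun setT (fun z => complex.Re (rademacher_poly xi s a z)) /\
  measurable_fun setT (fun z => complex.Im (rademacher_poly xi s a z)).
Proof.
have mxi k : measurable_fun setT (fun z : Omega * R => xi k z.1).
  exact: measurableT_comp.
have lin k : measurable_fun setT (fun z : Omega * R => 2 * pi * k%:~R * z.2).
  exact: measurable_funM.
have mcos k : measurable_fun setT
    (fun z : Omega * R => cos (2 * pi * k%:~R * z.2)).
  apply: measurableT_comp => //.
  by apply: continuous_measurable_fun; exact: continuous_cos.
have msin k : measurable_fun setT
    (fun z : Omega * R => sin (2 * pi * k%:~R * z.2)).
  apply: measurableT_comp => //.
  by apply: continuous_measurable_fun; exact: continuous_sin.
elim: s => [|k s [IHr IHi]].
  by split; rewrite (_ : (fun _ => _) = cst 0)//;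
    apply/funext => z; rewrite /rademacher_poly big_nil.
split.
- rewrite (_ : (fun _ => _) = (fun z => complex.Re (a k) *
      (xi k z.1 * cos (2 * pi * k%:~R * z.2))
    - complex.Im (a k) * (xi k z.1 * sin (2 * pi * k%:~R * z.2))
    + complex.Re (rademacher_poly xi s a z))).
    by apply: measurable_funD => //; apply: measurable_funB;
      apply: measurable_funM => //; exact: measurable_funM.
  apply/funext => z; rewrite /rademacher_poly big_cons.
  case: (\sum_(_ <- _) _) => u v; case: (a k) => p q /=.
  by rewrite !mul0r subr0 addr0.
- rewrite (_ : (fun _ => _) = (fun z => complex.Re (a k) *
      (xi k z.1 * sin (2 * pi * k%:~R * z.2))
    + complex.Im (a k) * (xi k z.1 * cos (2 * pi * k%:~R * z.2))
    + complex.Im (rademacher_poly xi s a z))).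
    by apply: measurable_funD => //; apply: measurable_funD;
      apply: measurable_funM => //; exact: measurable_funM.
  apply/funext => z; rewrite /rademacher_poly big_cons.
  case: (\sum_(_ <- _) _) => u v; case: (a k) => p q /=.
  by rewrite !mul0r subr0 addr0.
Qed.

Lemma measurable_sqnormc_rademacher_poly s a D :
  measurable_fun D (fun z => (sqnormc (rademacher_poly xi s a z))%:E).
Proof.
have [mr mi] := measurable_rademacher_poly s a.
apply: measurable_funTS; apply: measurableT_comp => //.
rewrite (_ : (fun _ => _) =
  (fun z => complex.Re (rademacher_poly xi s a z) ^+ 2 +
            complex.Im (rademacher_poly xi s a z) ^+ 2)).
  by apply: measurable_funD; exact: measurable_funX.
by apply/funext => z; rewrite sqnormcE.
Qed.

Definition sign_event (s : seq int) (B : int -> set R) : set Omega :=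
  \bigcap_(k in [set` s]) (xi k @^-1` B k).

Lemma measurable_sign_event s B : (forall k, measurable (B k)) ->
  measurable (sign_event s B).
Proof.
move=> mB; apply: fin_bigcap_measurable; first exact: finite_seq.
by move=> k _; rewrite -[X in measurable X]setTI; exact: measurable_funPT.
Qed.

Lemma normc_rademacher_poly_le s a z : (forall k, k \in s -> `|xi k z.1| <= 1) ->
  ComplexField.Normc.normc (rademacher_poly xi s a z) <=
  \sum_(k <- s) ComplexField.Normc.normc (a k).
Proof.
rewrite /rademacher_poly; elim: s => [|k s IH] h.
  by rewrite !big_nil ComplexField.Normc.normc0.
rewrite !big_cons; apply: (le_trans (le_normcD _ _)); apply: lerD; last first.
  by apply: IH => j js; apply: h; rewrite inE js orbT.
rewrite !ComplexField.Normc.normcM -[leRHS]mulr1 ler_wpM2l//.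
  by case: (a k) => p q; exact: sqrtr_ge0.
rewrite /= cos2Dsin2 sqrtr1 mulr1 expr0n addr0 sqrtr_sqr.
by apply: h; rewrite mem_head.
Qed.

Hypothesis xi_rademacher : forall k, rademacher (xi k).
Hypothesis xi_indep : mutually_independent xi.

(** Each factor of the product rule is 1/2 + 1/2. *)
Lemma rademacher_as_unit s :
  P (sign_event s (fun=> [set 1] `|` [set -1])) = 1%E.
Proof.
have -> : sign_event s (fun=> [set 1] `|` [set -1]) =
          sign_event (undup s) (fun=> [set 1] `|` [set -1]).
  by apply/seteqP; split => w h k /= ks; apply: h; rewrite /= ?mem_undup in ks *.
rewrite xi_indep ?undup_uniq//; last by move=> k _; exact: measurableU.
rewrite big1// => k _; rewrite preimage_setU measureU.
- have [h1 hN1] := xi_rademacher k.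
  rewrite [X in (X + _)%E]h1 [X in (_ + X)%E]hN1 -EFinD.
  by rewrite (_ : 2^-1 + 2^-1 = 1)//; lra.
- by rewrite -[X in measurable X]setTI; exact: measurable_funPT.
- by rewrite -[X in measurable X]setTI; exact: measurable_funPT.
- apply/seteqP; split => // w [/= -> /eqP].
  by rewrite -addr_eq0 (_ : 1 + 1 = 2%:R)// pnatr_eq0.
Qed.

Lemma measurable_Q : measurable (@Q d Omega R).
Proof. exact: measurableX. Qed.

(** The measurable structure on which lebesgue_measure is declared is only
    convertible to the canonical one on R.  Stating this formula, and the
    comparisons below, with the canonical structure makes them usable for
    rewriting. *)
Lemma product_muE A B : measurable A -> measurable B ->
  mu (A `*` B) = (P A * lebesgue_measure B)%E.
Proof. by move=> mA mB; exact: product_measure1E. Qed.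

Lemma sqintegral_le s a (A : set (Omega * R)) (M : R) : measurable A ->
  (forall z, A z -> sqnormc (rademacher_poly xi s a z) <= M) ->
  (sqintegral P A (rademacher_poly xi s a) <= M%:E * mu A)%E.
Proof.
move=> mA fM; rewrite /sqintegral -(integral_cst mu mA).
apply: ge0_le_integral => //.
- by move=> z _; rewrite lee_fin sqnormc_ge0.
- exact: measurable_sqnormc_rademacher_poly.
Qed.

Lemma sqintegral_ge s a (A : set (Omega * R)) (M : R) : measurable A ->
  0 <= M -> (forall z, A z -> M <= sqnormc (rademacher_poly xi s a z)) ->
  (M%:E * mu A <= sqintegral P A (rademacher_poly xi s a))%E.
Proof.
move=> mA M0 fM; rewrite /sqintegral -(integral_cst mu mA).
apply: ge0_le_integral => //.
exact: measurable_sqnormc_rademacher_poly.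
Qed.

Lemma sqintegral_subset s a (A B : set (Omega * R)) : measurable A ->
  measurable B -> A `<=` B ->
  (sqintegral P A (rademacher_poly xi s a) <=
   sqintegral P B (rademacher_poly xi s a))%E.
Proof.
move=> mA mB AB; apply: ge0_subset_integral => //.
- exact: measurable_sqnormc_rademacher_poly.
- by move=> z _; rewrite lee_fin sqnormc_ge0.
Qed.

Lemma sqintegral_negligible s a (A N : set (Omega * R)) : measurable A ->
  measurable N -> mu N = 0%E ->
  sqintegral P A (rademacher_poly xi s a) =
  sqintegral P (A `\` N) (rademacher_poly xi s a).
Proof.
move=> mA mN N0; apply: ge0_negligible_integral => //.
- exact: measurable_sqnormc_rademacher_poly.
- by move=> z _; rewrite lee_fin sqnormc_ge0.
Qed.

(** The approximation property is trivial, as the function is itself in the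
    span.  Square integrability holds because, off the null set where some
    xi_k is neither 1 nor -1, the polynomial is bounded by the sum of the
    moduli of its coefficients. *)
Lemma rademacher_poly_L2_RF s a : L2_RF xi (rademacher_poly xi s a).
Proof.
have [mr mi] := measurable_rademacher_poly s a.
split; last first.
  move=> e e0; exists s, a; rewrite /sqintegral.
  rewrite (eq_integral (cst 0%E)) ?integral0 ?lte_fin// => z _.
  by rewrite /= subrr /sqnormc ComplexField.Normc.normc0 expr0n.
split; [exact: measurable_funTS|exact: measurable_funTS|].
set G := sign_event s (fun=> [set 1] `|` [set -1]).
have mG : measurable G by apply: measurable_sign_event => k; exact: measurableU.
pose Z : set (Omega * R) := (~` G) `*` `[0, 1[%classic.
have mZ : measurable Z.
  by apply: measurableX => //; exact: measurableC.
have Z0 : mu Z = 0%E.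
  rewrite /Z product_muE//; last exact: measurableC.
  by rewrite probability_setC// rademacher_as_unit subee// mul0e.
have mD : measurable (@Q d Omega R `\` Z).
  by apply: measurableD => //; exact: measurable_Q.
set M := \sum_(k <- s) ComplexField.Normc.normc (a k).
rewrite (sqintegral_negligible _ _ measurable_Q mZ Z0).
apply: (@le_lt_trans _ _ ((M ^+ 2)%:E * mu (@Q d Omega R `\` Z))%E).
  apply: sqintegral_le => // -[w t] [[_ /= t01] nZ].
  have n0 x : 0 <= ComplexField.Normc.normc x :> R.
    by case: x => p q; exact: sqrtr_ge0.
  have Gw : G w by apply: contrapT => nGw; apply: nZ.
  rewrite ler_sqr ?nnegrE ?sumr_ge0// normc_rademacher_poly_le// => k ks.
  by have [->|->] := Gw k ks; rewrite ?normrN normr1.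
apply: (@le_lt_trans _ _ ((M ^+ 2)%:E * mu (@Q d Omega R))%E).
  apply: lee_pmul => //; first by rewrite lee_fin sqr_ge0.
  by apply: le_measure; rewrite ?inE//; exact: measurable_Q.
rewrite /Q product_muE// probability_setT mul1e lebesgue_measure_itv/=.
by rewrite lte_fin ltr01 -EFinB -EFinM ltry.
Qed.

(** * The binomial polynomial and the alternating event *)

Section AlternatingSigns.
Variable N : nat.

Definition freqs : seq int := map Posz (iota 0 N.+1).

Definition alternating_event : set Omega :=
  sign_event freqs (fun k => [set (-1) ^+ `|k|%N]).

Definition binomial_poly : Omega * R -> R[i]%C :=
  rademacher_poly xi freqs (fun k => 'C(N, `|k|%N)%:R).

Lemma measurable_alternating_event : measurable alternating_event.
Proof. exact: measurable_sign_event. Qed.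

Lemma probability_alternating_event :
  P alternating_event = ((2 ^+ N.+1)^-1)%:E.
Proof.
rewrite /alternating_event /sign_event xi_indep//; last first.
  by rewrite map_inj_uniq ?iota_uniq// => i j [].
rewrite big_map (eq_bigr (fun=> (2^-1)%:E)).
  by rewrite prodEFin big_const_seq count_predT iter_mulr_1 size_iota exprVn.
move=> k _; have [h1 hN1] := xi_rademacher (Posz k).
by rewrite /= -signr_odd; case: (odd k); rewrite ?expr0 ?expr1.
Qed.

(** The binomial expansion of (1 - e_1)^N, whose signs are those imposed by
    the event. *)
Lemma binomial_polyE z : alternating_event z.1 ->
  binomial_poly z = (1 - fourier_char 1 z.2) ^+ N.
Proof.
move=> zA; rewrite exprDn /binomial_poly /rademacher_poly big_map.
rewrite -(big_mkord xpredT
  (fun i => 1 ^+ (N - i) * (- fourier_char 1 z.2) ^+ i *+ 'C(N, i))).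
rewrite /index_iota subn0; apply: eq_big_seq => k kN /=.
have -> : xi k z.1 = (-1) ^+ k by apply: (zA k); rewrite /= map_f.
rewrite expr1n mul1r fourier_charX [(- fourier_char _ _) ^+ _]exprNn.
rewrite -[RHS]mulr_natl; congr (_ * (_ * _)); by rewrite rmorphXn rmorphN1.
Qed.

Lemma binomial_poly_small (h : R) :
  (sqintegral P (alternating_event `*` `[0%R, h[) binomial_poly <=
   ((16 * h) ^+ N)%:E * mu (alternating_event `*` `[0%R, h[))%E.
Proof.
apply: sqintegral_le.
  by apply: measurableX => //; exact: measurable_alternating_event.
move=> [w t] [/= Aw]; rewrite in_itv/= => /andP[t0 th].
rewrite -/(binomial_poly (w, t)) binomial_polyE// sqnormcX.
rewrite lerXn2r ?nnegrE ?sqnormc_ge0//=.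
  lra.
apply: le_trans (sqnormc_1Bfourier_char_le t0) _; lra.
Qed.

(** Only the same event, with theta in a quarter of the circle away from the
    zero of 1 - e_1, is kept. *)
Lemma binomial_poly_large :
  (((2 ^+ (N + 3))^-1)%:E <= sqintegral P (@Q d Omega R) binomial_poly)%E.
Proof.
have mA := measurable_alternating_event.
pose F : set (Omega * R) := alternating_event `*` `[4^-1, 2^-1[%classic.
have mF : measurable F by exact: measurableX.
apply: (@le_trans _ _ (sqintegral P F binomial_poly)).
  apply: (@le_trans _ _ (1%:E * mu F)%E).
    rewrite product_muE// probability_alternating_event lebesgue_measure_itv/=.
    rewrite lte_fin ifT; last lra.
    rewrite mul1e -EFinB -EFinM lee_fin.
    have -> : 2^-1 - 4^-1 = (2 ^+ 2)^-1 :> R by lra.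
    by rewrite -invfM -exprD addnS addSn.
  apply: sqintegral_ge => // -[w t] [/= Aw]; rewrite in_itv/= => /andP[t1 t2].
  rewrite -/(binomial_poly (w, t)) binomial_polyE// sqnormcX exprn_ege1//=.
  by apply: sqnormc_1Bfourier_char_ge1; rewrite t1 ltW.
apply: sqintegral_subset => //; first exact: measurable_Q.
move=> [w t] [_ /=]; rewrite in_itv/= => /andP[t1 t2].
by split => //=; rewrite in_itv/=; apply/andP; split; lra.
Qed.

End AlternatingSigns.

End RademacherPolynomials.

(** * Conclusion *)

(** With L = (2N + 6) ln 2, write L^alpha = L^2 / L^(2 - alpha).  As N >= 1
    and ln 2 <= 1, L^2 <= 64 N^2 ln 2, so it is enough that
    L^(2 - alpha) > 64 C, which holds for N large since L is unbounded. *)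
Lemma quadratic_beats_powR (R : realType) (alpha C : R) : alpha < 2 -> 0 < C ->
  exists N : nat, C * (ln (2 ^+ (2 * N + 6)) `^ alpha) < ln (2 ^+ (N * N)).
Proof.
move=> alpha2 C0.
have l0 : 0 < ln 2 :> R by apply: ln_gt0; lra.
have l1 : ln 2 <= 1 :> R by apply: (@le_ln1Dx R 1); lra.
(* B is the value above which L ^ (2 - alpha) > 64 C; N makes N ln 2, hence L, exceed it. *)
set B := (64 * C) `^ (2 - alpha)^-1.
set N := (Num.truncn (B / ln 2)).+1; exists N.
have BN : B < ln 2 * N%:R by rewrite mulrC -ltr_pdivrMr// truncnS_gt.
have N1 : 1 <= N%:R :> R by rewrite ler1n.
rewrite !lnXn// -[ltRHS]mulr_natr natrM.
have -> : ln 2 *+ (2 * N + 6) = ln 2 * (2 * N%:R + 6) :> R.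
  by rewrite -[LHS]mulr_natr natrD natrM.
set L := ln 2 * (_ + _).
have BL : B < L by rewrite /L; nra.
have B0 : 0 <= B by exact: powR_ge0.
have L0 : 0 < L by exact: le_lt_trans BL.
have : 64 * C < L `^ (2 - alpha).
  rewrite (_ : 64 * C = B `^ (2 - alpha)); last first.
    by rewrite /B -powRrM mulVf ?powRr1//; lra.
  by apply: gt0_ltr_powR => //; rewrite ?nnegrE ?ltW// subr_gt0.
rewrite -(ltr_pM2r (powR_gt0 alpha L0)) -powRD; last first.
  by apply/implyP => _; rewrite gt_eqF.
rewrite subrK powR_mulrn ?ltW// => h.
have : L ^+ 2 <= 64 * (ln 2 * (N%:R * N%:R)).
  have -> : 64 * (ln 2 * (N%:R * N%:R)) = ln 2 * (8 * N%:R) ^+ 2 :> R by ring.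
  rewrite /L exprMn; apply: ler_pM; rewrite ?sqr_ge0//.
    by rewrite expr2 ler_piMr// ltW.
  by apply: lerXn2r; rewrite ?nnegrE; lra.
lra.
Qed.

Theorem mainTheorem2 (R : realType) (d : measure_display)
    (Omega : measurableType d) (P : probability Omega R)
    (xi : int -> {RV P >-> R})
    (xi_rademacher : forall k, rademacher (xi k))
    (xi_indep : mutually_independent xi)
    (alpha C : R) (alpha_lt2 : alpha < 2) (C_gt0 : 0 < C) :
  exists (f : Omega * R -> R[i]%C) (E : set (Omega * R)),
    [/\ L2_RF xi f, measurable E, E `<=` Q,
        (0 < (P \x lebesgue_measure) E)%E &
        ((expR (C * ln (2 / fine ((P \x lebesgue_measure) E)%E) `^ alpha))%:E
           * sqintegral P E f < sqintegral P Q f)%E].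
Proof.
have [N hN] := quadratic_beats_powR alpha_lt2 C_gt0.
pose h : R := (2 ^+ (N + 4))^-1.
have h0 : 0 < h by rewrite invr_gt0 exprn_gt0.
have mA := measurable_alternating_event xi N.
pose E : set (Omega * R) := alternating_event xi N `*` `[0, h[%classic.
have muE : (P \x lebesgue_measure)%E E = ((2 ^+ (2 * N + 5))^-1)%:E.
  rewrite product_muE// (probability_alternating_event xi_rademacher xi_indep).
  rewrite lebesgue_measure_itv/= lte_fin h0 -EFinB -EFinM subr0 /h -invfM -exprD.
  by congr ((2 ^+ _)^-1)%:E; rewrite mul2n -addnn !addnS !addn0 addSn.
exists (binomial_poly xi N), E; split.
- exact: rademacher_poly_L2_RF.
- exact: measurableX.
- move=> [w t] [_ /=]; rewrite in_itv/= => /andP[t0 th]; split => //=.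
  rewrite in_itv/= t0/=; apply: (lt_le_trans th).
  by rewrite invf_le1 ?exprn_gt0// exprn_ege1// ler1n.
- by rewrite muE lte_fin invr_gt0 exprn_gt0.
apply: lt_le_trans (binomial_poly_large xi_rademacher xi_indep N).
apply: (@le_lt_trans _ _ ((expR (C * ln (2 ^+ (2 * N + 6)) `^ alpha))%:E *
    ((2 ^+ (N * N))^-1 * (2 ^+ (2 * N + 5))^-1)%:E)%E).
  (* On E, |f|^2 <= (16 h)^N = 2^-(N N), and 2 / mu E = 2^(2N + 6). *)
  rewrite muE /= invrK -exprS -addnS; apply: lee_pmul => //.
    by apply: integral_ge0 => z _; rewrite lee_fin sqnormc_ge0.
  apply: le_trans (binomial_poly_small xi N h) _.
  rewrite muE -EFinM lee_fin (_ : 16 * h = (2 ^+ N)^-1).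
    by rewrite exprVn -exprM.
  rewrite /h exprD invfM; field; by rewrite expf_neq0.
rewrite -EFinM lte_fin mulrA.
apply: (@lt_le_trans _ _ ((2 ^+ (2 * N + 5))^-1)).
  rewrite gtr_pMl ?invr_gt0 ?exprn_gt0// ltr_pdivrMr ?exprn_gt0// mul1r.
  by rewrite -[ltRHS]lnK ?posrE ?exprn_gt0// ltr_expR.
rewrite lef_pV2 ?posrE ?exprn_gt0// ler_eXn2l ?ltr1n//.
by rewrite mul2n -addnn -addnA leq_add2l ltnW// ltn_addl.
Qed.
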